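(* For Minimum Spanning Forest in the Late Accept model, the competitive ratio is $W$, where $W$ is the ratio between the largest and the smallest edge weight in the input graph. That is: (i) there is an online algorithm $\mathrm{ALG}$ in the Late Accept model such that $\mathrm{ALG}(\sigma)\le W\cdot\mathrm{OPT}(\sigma)$ for every input $\sigma$ with weight ratio $W$; and (ii) for every fixed real $W\ge 1$ and every real $c<W$, there are no online algorithm $\mathrm{ALG}$ in the Late Accept model and constant $\alpha$ such that $\mathrm{ALG}(\sigma)\le c\,\mathrm{OPT}(\sigma)+\alpha$ for all inputs $\sigma$ with weight ratio $W$.
   Context: Online Minimum Spanning Forest (edge arrival). An input $\sigma$ is a finite simple undirected graph $G=(V,E)$ with a weight function $w\colon E\to\mathbb{R}^+$ and an ordering of its edges. Edges arrive one by one in this order with their weights; endpoints not seen before are revealed with the edge. The weight ratio of $\sigma$ is $W=\max_{e\in E}w(e)/\min_{e\in E}w(e)$. All online algorithms are deterministic: each decision depends only on the part of the input revealed so far. After each arrival has been processed, the set of currently accepted edges must be a spanning forest of the graph revealed so far, i.e., it must form a spanning tree on each connected component of that graph. $\mathrm{ALG}(\sigma)$ is the total weight of the accepted edges at the end of the input, and $\mathrm{OPT}(\sigma)$ is the minimum total weight of a spanning forest of $G$; the objective is minimization. Late Accept model: in each step the algorithm may accept the newly arrived edge and/or any earlier edges that are not yet accepted; acceptance is irrevocable, i.e., an accepted edge can never be removed. *)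

(* Defs.v *)
From HB Require Import structures.
From mathcomp Require Import all_boot all_order all_algebra.
From mathcomp Require Import finmap boolp classical_sets reals.

Set Implicit Arguments.
Unset Strict Implicit.
Unset Printing Implicit Defensive.

Import Order.TTheory GRing.Theory Num.Theory.

Local Open Scope fset_scope.
Local Open Scope ring_scope.

(* Vertices are named by natural numbers; an edge is the (unordered) set of
   its endpoints. *)
Notation vertex := nat (only parsing).
Notation edge := {fset nat} (only parsing).

Section Graphs.
Implicit Types (V C : {fset vertex}) (E F T : {fset edge}) (u v : vertex).

Definition adj E : rel vertex := fun u v => [fset u; v] \in E.

Definition reachable E u v : Prop :=
  exists p : seq vertex, path (adj E) u p /\ last u p = v.

Definition component V E u : {fset vertex} :=
  [fset v in V | `[< reachable E u v >]].

(* A cycle has at least three vertices: as [adj] is symmetric, a single edge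
   is already a closed walk of length two. *)
Definition acyclic E : Prop :=
  forall c : seq vertex, uniq c -> (2 < size c)%N -> ~ cycle (adj E) c.

Definition is_tree C T : Prop :=
  [/\ C != fset0,
      forall e, e \in T -> e `<=` C,
      forall u v, u \in C -> v \in C -> reachable T u v
    & acyclic T].

Definition spanning_forest V E F : Prop :=
  F `<=` E /\
  forall u, u \in V ->
    is_tree (component V E u) [fset e in F | e `<=` component V E u].

End Graphs.

(* The edge set of the graph is given by its arrival order; only the values of
   [weight] on these edges are meaningful. *)
Record input (R : realType) := Input {
  vertices : {fset vertex};
  edges : seq edge;
  weight : edge -> R;
  edges_uniq : uniq edges;
  edges_simple :
    forall e, e \in edges -> #|` e| = 2%N /\ e `<=` vertices;
  weight_gt0 : forall e, e \in edges -> 0 < weight e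
}.

Section Online.
Variable R : realType.
Implicit Types (s : input R) (i : nat) (F : {fset edge}).

Definition edge_set s : {fset edge} := [fset e in edges s].

Definition total_weight s F : R := \sum_(e <- F) weight s e.

Definition max_weight s : R := \big[Num.max/0]_(e <- edges s) weight s e.

(* The default value [max_weight s] of the iterated minimum is harmless since
   it is at least every weight. On an edgeless input, where the ratio is not
   defined, [weight_ratio] takes the value 0. *)
Definition min_weight s : R :=
  \big[Num.min/max_weight s]_(e <- edges s) weight s e.

Definition weight_ratio s : R := max_weight s / min_weight s.

(* The infimum ranges over a finite nonempty set, hence is a minimum. *)
Definition opt s : R :=
  inf [set total_weight s F | F in spanning_forest (vertices s) (edge_set s)].

Definition revealed s i : seq (edge * R) :=
  [seq (e, weight s e) | e <- take i (edges s)].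

Definition revealed_edges s i : {fset edge} := [fset e in take i (edges s)].

Definition revealed_vertices s i : {fset vertex} :=
  \bigcup_(e <- take i (edges s)) e.

(* A deterministic online algorithm maps what has been revealed so far to the
   set of currently accepted edges. *)
Definition algorithm := seq (edge * R) -> {fset edge}.

Definition accepted (A : algorithm) s i : {fset edge} := A (revealed s i).

(* Monotonicity is the irrevocability of acceptance; earlier edges may be
   accepted at any later step. *)
Definition late_accept (A : algorithm) : Prop :=
  forall s,
    (forall i, (i <= size (edges s))%N ->
      spanning_forest (revealed_vertices s i) (revealed_edges s i)
        (accepted A s i)) /\
    (forall i, (i < size (edges s))%N ->
      accepted A s i `<=` accepted A s i.+1).

Definition alg (A : algorithm) s : R :=
  total_weight s (accepted A s (size (edges s))).

End Online.

(* Main.v *)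
(* Greedily accepting the arriving edges that close no cycle is a feasible
   strategy. By the exchange property all spanning forests of a graph have the
   same number of edges, so any two of them differ in weight by a factor of at
   most W; this bounds every Late Accept algorithm.

   For the lower bound, first present a star with n + 1 edges of weight W: all
   of them must be accepted at once. Then present n edges of weight 1 that join
   the leaves along a path. The algorithm pays at least W (n + 1), whereas the path
   through all the vertices costs W + n, and the ratio tends to W. *)
Require Import Defs.
From mathcomp Require Import all_boot all_order all_algebra.
From mathcomp Require Import finmap boolp classical_sets reals.
From mathcomp Require Import lra.

Set Implicit Arguments.
Unset Strict Implicit.
Unset Printing Implicit Defensive.

Import Order.TTheory GRing.Theory Num.Theory.
Local Open Scope ring_scope.

(** * Walks, cycles and spanning forests of graphs given by edge sets *)

Section Graphs.
Local Open Scope fset_scope.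
Implicit Types (V C e : {fset nat}) (E F G : {fset {fset nat}}) (u v x y : nat).

Lemma fset2C u v : [fset u; v] = [fset v; u].
Proof. exact: fsetUC. Qed.

Lemma fset2_inj u v x y :
  [fset u; v] = [fset x; y] -> (u = x /\ v = y) \/ (u = y /\ v = x).
Proof.
move=> eq_uv.
have /fset2P ux : u \in [fset x; y] by rewrite -eq_uv fset21.
have /fset2P vx : v \in [fset x; y] by rewrite -eq_uv fset22.
have /fset2P xu : x \in [fset u; v] by rewrite eq_uv fset21.
have /fset2P yu : y \in [fset u; v] by rewrite eq_uv fset22.
by case: ux vx xu yu => [] ? [] ? [] ? [] ?; subst; auto.
Qed.

Lemma card2_fsetP e : #|` e| = 2%N -> exists u v, u != v /\ e = [fset u; v].
Proof.
move=> e2; have /fset0Pn [u ue] : e != fset0 by rewrite -cardfs_gt0 e2.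
move: e2; rewrite (cardfsD1 u) ue add1n => -[] /eqP /cardfs1P [v ev].
exists u, v; rewrite -(fsetD1K ue) ev; split=> //.
by have := fset11 v; rewrite -ev in_fsetD1 eq_sym => /andP[].
Qed.

Lemma adj_sym E : symmetric (adj E).
Proof. by move=> u v; rewrite /adj fset2C. Qed.

Lemma reachable_refl E u : reachable E u u.
Proof. by exists [::]. Qed.

Lemma reachable_trans E x u v :
  reachable E u x -> reachable E x v -> reachable E u v.
Proof.
move=> [p [pP <-]] [q [qP <-]]; exists (p ++ q).
by rewrite cat_path last_cat pP qP.
Qed.

Lemma reachable_adj E u v : adj E u v -> reachable E u v.
Proof. by move=> uv; exists [:: v]; rewrite /= uv. Qed.

Lemma reachable_sym E u v : reachable E u v -> reachable E v u.
Proof.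
move=> [p [pP <-]]; exists (rev (belast u p)).
rewrite rev_path -(eq_path (adj_sym E)) pP; split=> //.
by case: p {pP} => //= w p; rewrite rev_cons last_rcons.
Qed.

Lemma sub_reachable E F u v :
  (forall x y, adj E x y -> reachable F x y) ->
  reachable E u v -> reachable F u v.
Proof.
move=> EF [p []]; elim: p u => [|w p IHp] u /=.
  by move=> _ <-; apply: reachable_refl.
by move=> /andP[/EF uw /IHp wp] /wp; apply: reachable_trans.
Qed.

Lemma reachableS E F u v : E `<=` F -> reachable E u v -> reachable F u v.
Proof.
by move=> /fsubsetP EF; apply: sub_reachable => x y /EF; apply: reachable_adj.
Qed.

(** One crossing of the new edge suffices: a second crossing leads back to an endpoint already
    visited, so the part of the walk in between can be cut out. *)
Lemma reachable_add E x y u v : reachable ([fset x; y] |` E) u v ->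
  [\/ reachable E u v, reachable E u x /\ reachable E y v
    | reachable E u y /\ reachable E x v].
Proof.
move=> [p []]; elim: p u => [|w p IHp] u /=.
  by move=> _ ->; constructor 1; apply: reachable_refl.
move=> /andP[uw /IHp wp] /wp {IHp wp}.
move: uw; rewrite /adj in_fset1U => /orP[/eqP/fset2_inj|].
  have refl := reachable_refl E.
  by case=> -[-> ->] [?|[_ ?]|[_ ?]];
    [constructor 2|constructor 2|constructor 1
    |constructor 3|constructor 1|constructor 3].
move=> /reachable_adj /reachable_trans uw.
by case=> [/uw|[/uw]|[/uw]]; [constructor 1|constructor 2|constructor 3].
Qed.

(** * Acyclicity in terms of bridges, and the exchange argument *)

Lemma acyclicS E F : E `<=` F -> acyclic F -> acyclic E.
Proof.
move=> /fsubsetP EF aF c Uc c2 cE; apply: (aF c Uc c2).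
by apply: sub_cycle cE => x y /EF.
Qed.

(** A walk from [u] to [v] that avoids the edge, shortened to a simple path, is closed to a cycle by
    that edge. The path is not a single step, since that step would be the removed edge, so the
    cycle has at least three vertices. *)
Lemma acyclic_bridge E u v :
  acyclic E -> u != v -> adj E u v -> ~ reachable (E `\ [fset u; v]) u v.
Proof.
move=> aE uv Euv [p [/shortenP[q qP Uq _] lq]]; apply: (aE (u :: q) Uq).
  case: q lq qP {Uq} => [|w [|//]] /= wv; first by rewrite wv eqxx in uv.
  by rewrite wv /adj in_fsetD1 eqxx.
rewrite /= rcons_path lq adj_sym Euv andbT.
by apply: sub_path qP => x y; rewrite /adj in_fsetD1 => /andP[].
Qed.

(** On a cycle u, v, w, ... the way round through w leads from v back to u. Its edges differ from
    {u, v} because the vertices are distinct: the first edge contains w but not u, the inner ones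
    avoid v, and so does the last. *)
Lemma bridge_acyclic E :
  (forall u v, u != v -> adj E u v -> ~ reachable (E `\ [fset u; v]) u v) ->
  acyclic E.
Proof.
move=> bE [|u [|v [|w c]]] // Uc _ cE.
have [uv Euv] : u != v /\ adj E u v.
  by move: Uc cE => /=; rewrite in_cons negb_or =>
    /andP[/andP[-> _] _] /andP[->].
apply: (bE u v uv Euv); apply: reachable_sym.
exists (rcons (w :: c) u); split; last by rewrite last_rcons.
move: cE => /= /andP[_].
have := Uc; rewrite /= !inE !negb_or -!andbA.
move=> /and5P[_ uw uc vw /and3P[vc _ _]].
rewrite {1 3}/adj !in_fsetD1 => /andP[-> cE]; rewrite andbT; apply/andP; split.
  apply/eqP => /fset2_inj; move: uv uw vw => /eqP ? /eqP ? /eqP ?.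
  by move=> [[]|[]] *; congruence.
move: cE; rewrite !rcons_path => /andP[cE Elast]; apply/andP; split.
  have {vw vc} : v \notin w :: c by rewrite in_cons negb_or vw.
  elim: c w cE {uc uw Uc Elast} => //= z c IHc w /andP[Ewz /IHc cE].
  rewrite in_cons negb_or => /andP[vw vc]; rewrite cE // andbT.
  rewrite /adj in_fsetD1 andbC; apply/andP; split=> //.
  move: vc; rewrite in_cons negb_or => /andP[/eqP vz _].
  by apply/eqP => /fset2_inj; move: vw => /eqP ? [[]|[]] *; congruence.
rewrite /adj in_fsetD1 andbC; apply/andP; split=> //.
have : last w c != v.
  apply: contraNneq vw => lv; move: (mem_last w c).
  by rewrite lv in_cons (negPf vc) orbF.
move: uv => /eqP ? /eqP ?.
by apply/eqP => /fset2_inj [[]|[]] *; congruence.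
Qed.

(** By the bridge criterion. The new edge is a bridge since [E] does not connect its ends. A detour
    around an old edge would have to cross the new edge; its two remaining pieces, together with the
    old edge, would then connect [x] and [y] within [E]. *)
Lemma acyclic_add E x y :
  acyclic E -> ~ reachable E x y -> acyclic ([fset x; y] |` E).
Proof.
move=> aE xy; apply: bridge_acyclic => u v uv.
have [Exy|Exy] := boolP ([fset x; y] \in E).
  by case: xy; apply: reachable_adj.
have sub : ([fset x; y] |` E) `\ [fset u; v]
    `<=` [fset x; y] |` (E `\ [fset u; v]).
  by apply/fsubsetP => e; rewrite !inE => /andP[-> /orP[->|->]]; rewrite ?orbT.
rewrite /adj in_fset1U => /orP[/eqP uvxy|Euv].
  rewrite -uvxy in Exy *; rewrite fsetU1K // => ruv; apply: xy.
  by case: (fset2_inj uvxy) => -[<- <-] //; apply: reachable_sym.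
have subE : E `\ [fset u; v] `<=` E by apply: fsubD1set.
move=> /(reachableS sub)/reachable_add [].
- exact: acyclic_bridge.
- move=> [/(reachableS subE) ux /(reachableS subE) yv]; apply: xy.
  apply: reachable_trans (reachable_sym ux) _.
  apply: reachable_trans (reachable_sym yv); exact: reachable_adj.
move=> [/(reachableS subE) uy /(reachableS subE) xv]; apply: xy.
apply: reachable_trans xv _; apply: reachable_trans uy.
by apply: reachable_adj; rewrite adj_sym.
Qed.

(* Exchange argument: as long as [F] has an edge outside [E], that edge can be
   replaced by an edge of [E] without creating a cycle. *)
Lemma acyclic_card F E : (forall e, e \in F -> #|` e| = 2%N) -> acyclic F ->
  (forall u v, adj F u v -> reachable E u v) -> (#|` F| <= #|` E|)%N.
Proof.
have [n] := ubnP #|` F `\` E|; elim: n F => // n IHn F FEn F2 aF FE.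
have [|[e]] := fset_0Vmem (F `\` E).
  by move=> /eqP; rewrite fsetD_eq0 => /fsubset_leq_card.
rewrite in_fsetD => /andP[eE eF].
have [u [v [uv e_uv]]] := card2_fsetP (F2 e eF).
have Fuv : adj F u v by rewrite /adj -e_uv.
have nuv : ~ reachable (F `\ e) u v by rewrite e_uv; apply: acyclic_bridge.
(* Without [e] its endpoints are no longer connected in [F], yet [E] connects them; so some edge of
   [E] joins two different components of [F] minus [e]. *)
have [[x [y [Exy nxy]]]|E_F] :=
    pselect (exists x y, adj E x y /\ ~ reachable (F `\ e) x y); last first.
  case: nuv; apply: sub_reachable (FE _ _ Fuv) => x y Exy.
  by apply: contrapT => nxy; apply: E_F; exists x, y.
have xyF : [fset x; y] \notin F `\ e.
  by apply: contra_notN nxy; apply: reachable_adj.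
(* Replacing [e] by this edge preserves the cardinality and shrinks the difference of [F] and [E],
   the induction measure. *)
have -> : #|` F| = #|` [fset x; y] |` (F `\ e)|.
  by rewrite (cardfsD1 e) eF cardfsU1 xyF.
apply: IHn.
- rewrite -ltnS; apply: leq_ltn_trans FEn.
  have eFE : e \in F `\` E by rewrite in_fsetD eE.
  apply: leq_ltn_trans (fproper_ltn_card (fproperD1 eFE)).
  apply: fsubset_leq_card; apply/fsubsetP => f.
  rewrite !inE => /andP[fE /orP[/eqP fxy|/andP[-> ->]]]; last by rewrite fE.
  by rewrite fxy -/(adj E x y) Exy in fE.
- move=> f; rewrite !inE => /orP[/eqP->|/andP[_ /F2 //]].
  rewrite cardfs2; have [eq_xy|//] := eqVneq x y.
  by case: nxy; rewrite eq_xy; apply: reachable_refl.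
- apply: acyclic_add nxy; apply: acyclicS aF; exact: fsubD1set.
move=> a b; rewrite /adj in_fset1U => /orP[/eqP ab|].
  by apply: reachable_adj; rewrite /adj ab.
by rewrite in_fsetD1 => /andP[_]; apply: FE.
Qed.

(** As [F] lies in [E], a walk or cycle in [F] never leaves the component of its starting vertex, so
    the tree conditions on the components turn into global ones. Concrete forests are checked in
    this form, which does not mention [V]. *)
Lemma spanning_forestP V E F :
  (forall e, e \in E -> #|` e| = 2%N /\ e `<=` V) ->
  spanning_forest V E F <->
  [/\ F `<=` E, acyclic F & forall u v, adj E u v -> reachable F u v].
Proof.
move=> EV.
have inV u v : adj E u v -> u \in V.
  by move=> /EV[_ /fsubsetP]; apply; rewrite fset21.
have inC u v : (v \in component V E u) = (v \in V) && `[< reachable E u v >].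
  by rewrite /component !inE /=.
split=> [[FE trees]|[FE aF EF]].
  split=> // [c Uc c2 cF|u v Euv].
    case: c Uc c2 cF => // u c Uc c2 cF.
    have uV : u \in V.
      case: c cF {Uc c2} => /= [|w c] /andP[+ _] => /(fsubsetP FE); exact: inV.
    have [_ _ _ aC] := trees u uV; apply: (aC (u :: c) Uc c2).
    have sub w : path (adj F) w (rcons c u) -> reachable E u w ->
      path (adj [fset e in F | e `<=` component V E u]) w (rcons c u).
      elim: (rcons c u) w => //= b q IHq w /andP[Fwb bq] uw.
      have Ewb : adj E w b by exact: (fsubsetP FE).
      have ub : reachable E u b.
        by apply: reachable_trans uw _; apply: reachable_adj.
      rewrite IHq // andbT /adj !inE /= -/(adj F w b) Fwb /=.
      apply/fsubsetP => z /fset2P[] ->; rewrite inC.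
        by rewrite (inV w b) //; apply/asboolP.
      by rewrite (inV b w) 1?adj_sym //; apply/asboolP.
    by apply: sub cF _; apply: reachable_refl.
  have uV := inV _ _ Euv; have [_ _ conn _] := trees u uV.
  apply: (@reachableS [fset e in F | e `<=` component V E u]).
    by apply/fsubsetP => e; rewrite !inE => /andP[].
  apply: conn; rewrite inC ?uV; first by apply/asboolP; apply: reachable_refl.
  rewrite (inV v u) 1?adj_sym //; apply/asboolP; exact: reachable_adj.
split=> // u uV; split.
- apply/fset0Pn; exists u; rewrite inC uV; apply/asboolP.
  exact: reachable_refl.
- by move=> e; rewrite !inE => /andP[].
- move=> a b; rewrite !inC => /andP[aV /asboolP ua] /andP[bV /asboolP ub].
  have : reachable F a b.
    apply: sub_reachable EF _; apply: reachable_trans ub; exact: reachable_sym.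
  move=> [p [pF <-]]; exists p; split=> //.
  elim: p a aV ua pF {b bV ub} => //= b p IHp a aV ua /andP[Fab pF].
  have Eab : adj E a b by exact: (fsubsetP FE).
  have ub : reachable E u b.
    by apply: reachable_trans ua _; apply: reachable_adj.
  have bV : b \in V by apply: (inV b a); rewrite adj_sym.
  rewrite IHp // andbT /adj !inE /= -/(adj F a b) Fab /=.
  by apply/fsubsetP => z /fset2P[] ->; rewrite inC ?aV ?bV; apply/asboolP.
by apply: acyclicS aF; apply/fsubsetP => e; rewrite !inE => /andP[].
Qed.

End Graphs.

(** * Sums over edge sets, and feasibility of the greedy algorithm *)

Section OnlineForest.
Local Open Scope fset_scope.
Variable R : realType.
Implicit Types (s : input R) (F : {fset {fset nat}}) (w : {fset nat} -> R).

Lemma sum_fset_const F (x : R) : \sum_(e <- F) x = x * #|` F|%:R.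
Proof. by rewrite big_const_seq iter_addr_0 count_predT mulr_natr. Qed.

Lemma ler_sum_fset F w1 w2 : (forall e, e \in F -> w1 e <= w2 e) ->
  \sum_(e <- F) w1 e <= \sum_(e <- F) w2 e.
Proof.
by move=> w12; rewrite big_seq [leRHS]big_seq; apply: ler_sum.
Qed.

Lemma ler_sum_fsetS E F w : (forall e, 0 <= w e) -> E `<=` F ->
  \sum_(e <- E) w e <= \sum_(e <- F) w e.
Proof.
move=> w0 /fsubsetP EF; rewrite [leRHS](big_fsetID _ (mem E)) /=.
have -> : [fset x in F | x \in E] = E.
  by apply/fsetP => x; rewrite !inE /= andbC; case: (boolP (x \in E)) => // /EF.
by rewrite lerDl sumr_ge0.
Qed.

Lemma spanning_forest_input s F :
  spanning_forest (vertices s) (edge_set s) F <->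
  [/\ F `<=` edge_set s, acyclic F
    & forall u v, adj (edge_set s) u v -> reachable F u v].
Proof. by apply: spanning_forestP => e; rewrite !inE; apply: edges_simple. Qed.

Lemma spanning_forest_revealed s i F :
  spanning_forest (revealed_vertices s i) (revealed_edges s i) F <->
  [/\ F `<=` revealed_edges s i, acyclic F
    & forall u v, adj (revealed_edges s i) u v -> reachable F u v].
Proof.
apply: spanning_forestP => e; rewrite !inE /= => ei.
by split; [have [] := edges_simple (mem_take ei) | apply: bigfcup_sup].
Qed.

(** The accepted set is recomputed from the whole history, which makes it a function of the revealed
    input; the weights are ignored. *)
Definition greedy : algorithm R := foldl
  (fun F p => if `[< acyclic (p.1 |` F) >] then p.1 |` F else F) fset0.

Lemma acyclic0 : acyclic fset0.
Proof. by move=> [|x [|y c]] //= _ _; rewrite /adj in_fset0. Qed.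

Lemma greedy_rcons (l : seq {fset nat}) w e :
  greedy [seq (x, w x) | x <- l] `<=` greedy [seq (x, w x) | x <- rcons l e].
Proof.
rewrite map_rcons /greedy foldl_rcons /=.
by case: ifP => _; rewrite ?fsubsetU1 ?fsubset_refl.
Qed.

(** Induction over the arrivals. A rejected edge would close a cycle, so by [acyclic_add] its
    endpoints are connected already. *)
Lemma greedy_forest (l : seq {fset nat}) w :
  (forall e, e \in l -> #|` e| = 2%N) ->
  let F := greedy [seq (e, w e) | e <- l] in
  [/\ F `<=` [fset e in l], acyclic F
    & forall u v, adj [fset e in l] u v -> reachable F u v].
Proof.
elim/last_ind: l => [|l e IHl] l2 /=.
  split; [exact: fsub0set | exact: acyclic0 |].
  by move=> u v; rewrite /adj !inE.
have [|Fl aF lF] := IHl.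
  by move=> f fl; apply: l2; rewrite mem_rcons inE fl orbT.
have [x [y [xy e_xy]]] : exists x y, x != y /\ e = [fset x; y].
  by apply: card2_fsetP; apply: l2; rewrite mem_rcons mem_head.
have FF := greedy_rcons l w e.
have Fe : reachable (greedy [seq (x, w x) | x <- rcons l e]) x y.
  rewrite map_rcons /greedy foldl_rcons /= -/(greedy _).
  case: asboolP => [_|cyc].
    by apply: reachable_adj; rewrite /adj -e_xy fset1U1.
  by apply: contrapT => nxy; apply: cyc; rewrite e_xy; apply: acyclic_add.
split.
- rewrite map_rcons /greedy foldl_rcons /= -/(greedy _).
  have sub : greedy [seq (x, w x) | x <- l] `<=` [fset f in rcons l e].
    apply: fsubset_trans Fl _; apply/fsubsetP => f.
    by rewrite !inE /= mem_rcons inE => ->; rewrite orbT.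
  case: ifP => // _; rewrite fsubUset sub andbT fsub1set.
  by rewrite !inE /= mem_rcons mem_head.
- rewrite map_rcons /greedy foldl_rcons /= -/(greedy _).
  by case: asboolP.
move=> u v; rewrite /adj !inE /= mem_rcons inE => /orP[/eqP|uvl].
  rewrite [in X in _ = X -> _]e_xy => /fset2_inj[[-> ->]|[-> ->]] //.
  exact: reachable_sym.
by apply: reachableS FF _; apply: lF; rewrite /adj !inE.
Qed.

Lemma greedy_late_accept : late_accept greedy.
Proof.
move=> s; split=> i i_s.
  apply/spanning_forest_revealed; apply: greedy_forest => e /mem_take.
  by move=> /edges_simple[].
by rewrite /accepted /revealed (take_nth fset0 i_s); apply: greedy_rcons.
Qed.

(** * Upper bound for every Late Accept algorithm *)

Lemma accepted_spanning (A : algorithm R) s : late_accept A ->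
  spanning_forest (vertices s) (edge_set s) (accepted A s (size (edges s))).
Proof.
move=> /(_ s)[/(_ _ (leqnn _)) + _].
(* Isolated vertices of [s] are never revealed; the detour through the criterion without vertex set
   bridges this difference. *)
move/spanning_forest_revealed; rewrite /revealed_edges take_size => ?.
by apply/spanning_forest_input.
Qed.

Lemma spanning_forest_card s F F' :
  spanning_forest (vertices s) (edge_set s) F ->
  spanning_forest (vertices s) (edge_set s) F' -> (#|` F| <= #|` F'|)%N.
Proof.
move=> /spanning_forest_input[/fsubsetP Fs aF _].
move=> /spanning_forest_input[_ _ sF'].
apply: acyclic_card => // [e /Fs|u v /Fs /sF' //].
by rewrite !inE => /edges_simple[].
Qed.

Lemma le_max_weight s e : e \in edges s -> weight s e <= max_weight s.
Proof. by move=> es; apply: le_bigmax_seq. Qed.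

Lemma ge_min_weight s e : e \in edges s -> min_weight s <= weight s e.
Proof. by move=> es; apply: ge_bigmin_seq. Qed.

Lemma min_weight_gt0 s : edges s != [::] -> 0 < min_weight s.
Proof.
case E : (edges s) => [//|e l] _; have es : e \in edges s by rewrite E mem_head.
rewrite /min_weight big_seq; apply: lt_bigmin => [|f]; last exact: weight_gt0.
exact: lt_le_trans (weight_gt0 es) (le_max_weight es).
Qed.

Lemma late_accept_upper_bound (A : algorithm R) s :
  late_accept A -> alg A s <= weight_ratio s * opt s.
Proof.
move=> lA; have := accepted_spanning s lA; rewrite /alg.
set F := accepted _ _ _ => Fsp.
have Fs e : e \in F -> e \in edges s.
  by case: Fsp => /fsubsetP Fs _ /Fs; rewrite !inE.
(* On an edgeless input the ratio takes its default value 0, and the bound holds because nothing is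
   accepted. *)
have [E|/min_weight_gt0 m0] := eqVneq (edges s) [::].
  have -> : F = fset0 by apply/fsetP => e; apply/negP => /Fs; rewrite E.
  rewrite /weight_ratio /max_weight E big_nil !mul0r.
  by rewrite /total_weight big_seq_fset0.
have M0 : 0 <= max_weight s.
  exact: bigmax_ge_id.
(* Every competing forest has at least as many edges as [F], each of at least the minimum weight. *)
have optF : min_weight s * #|` F|%:R <= opt s.
  apply: lb_le_inf; first by exists (total_weight s F), F.
  move=> _ [F' F'sp <-].
  apply: (@le_trans _ _ (min_weight s * #|` F'|%:R)).
    by rewrite (ler_pM2l m0) ler_nat (spanning_forest_card Fsp).
  rewrite -sum_fset_const; apply: ler_sum_fset => e eF'; apply: ge_min_weight.
  by case: F'sp => /fsubsetP /(_ _ eF'); rewrite !inE.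
apply: (@le_trans _ _ (max_weight s * #|` F|%:R)).
  rewrite -sum_fset_const; apply: ler_sum_fset => e eF.
  exact: le_max_weight (Fs _ eF).
rewrite /weight_ratio -mulrA ler_wpM2l //.
by rewrite ler_pdivlMl.
Qed.

End OnlineForest.

Lemma in_fset_seq (T : choiceType) (s : seq T) (x : T) :
  (x \in [fset y in s]%fset) = (x \in s).
Proof. by rewrite in_fset. Qed.

(** * The adversarial input: a star followed by a path through its leaves *)

Section StarPath.
Local Open Scope fset_scope.
Variables (R : realType) (W : R).
Hypothesis W1 : 1 <= W.

Definition star n : seq {fset nat} := mkseq (fun i => [fset 0%N; i.+1]) n.

Definition rim n : seq {fset nat} := mkseq (fun i => [fset i.+1; i.+2]) n.

(** The centre is 0 and the leaves are 1, ..., n+1, one more than there are rim edges, so the rim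
    visits every leaf. *)
Definition star_path n : seq {fset nat} := star n.+1 ++ rim n.

(** Among the edges of [star_path] exactly the star edges contain the centre 0. *)
Definition star_weight (e : {fset nat}) : R := if 0%N \in e then W else 1.

Lemma star_path_uniq n : uniq (star_path n).
Proof.
rewrite cat_uniq !mkseq_uniq /= ?andbT.
- apply/hasPn => _ /mapP[i _ ->]; apply/mapP => -[j _].
  by move=> /fset2_inj[[]|[]].
- move=> i j /fset2_inj[[[]//]|[[->] [/eqP]]].
  by rewrite gtn_eqF.
- by move=> i j /fset2_inj[[_ []//]|[//]].
Qed.

Definition initial_vertices m : {fset nat} := [fset i in iota 0 m].

Lemma in_initial_vertices m i : (i \in initial_vertices m) = (i < m)%N.
Proof. by rewrite in_fset_seq mem_iota. Qed.

Lemma star_path_simple n e : e \in star_path n ->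
  #|` e| = 2%N /\ e `<=` initial_vertices n.+2.
Proof.
rewrite mem_cat => /orP[] /mapP[i + ->].
all: rewrite mem_iota cardfs2 add0n => /= i_n.
  by split=> //; apply/fsubsetP => x /fset2P[] ->; rewrite in_initial_vertices.
rewrite ltn_eqF //; split=> //; apply/fsubsetP => x.
by move=> /fset2P[] ->; rewrite in_initial_vertices !ltnS // ltnW.
Qed.

Lemma star_weight_gt0 e : 0 < star_weight e.
Proof. by rewrite /star_weight; case: ifP => // _; apply: lt_le_trans W1. Qed.

Definition star_path_input n : input R :=
  Input (star_path_uniq n) (@star_path_simple n) (fun e _ => star_weight_gt0 e).

(** A positive [n] provides a rim edge and thereby the weight 1; a lone star edge would have ratio
    1. *)
Lemma star_path_ratio n : (0 < n)%N -> weight_ratio (star_path_input n) = W.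
Proof.
move=> n0; set s := star_path_input n.
have star0 : [fset 0%N; 1%N] \in edges s.
  by rewrite mem_cat; apply/orP; left; apply/mapP; exists 0%N.
have rim0 : [fset 1%N; 2%N] \in edges s.
  by rewrite mem_cat; apply/orP; right;
    apply/mapP; exists 0%N; rewrite ?mem_iota.
have W0 : 0 <= W by apply: le_trans W1.
have -> : weight_ratio s = max_weight s / min_weight s by [].
have -> : max_weight s = W.
  apply/le_anti/andP; split.
    by apply: bigmax_le => // e _; rewrite /= /star_weight; case: ifP.
  by apply: le_trans (le_max_weight star0); rewrite /= /star_weight fset21.
suff -> : min_weight s = 1 by rewrite divr1.
apply/le_anti/andP; split.
  by apply: le_trans (ge_min_weight rim0) _; rewrite /= /star_weight !inE.
(* The remaining subgoal concerns the default value [max_weight s] of the iterated minimum, which is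
   at least the weight 1 of a rim edge. *)
apply: le_bigmin => [|e _]; last by rewrite /= /star_weight; case: ifP.
apply: le_trans (le_max_weight rim0) => /=; by rewrite /star_weight !inE.
Qed.

(** The last edge of the walk will do. This forces the edge at a leaf of the star, and shows that a
    fresh vertex is not yet connected to anything else. *)
Lemma reachable_edge (F : {fset {fset nat}}) u v :
  u != v -> reachable F u v -> exists2 e, e \in F & v \in e.
Proof.
move=> uv [p [+ lp]]; case/lastP: p lp => [/=|p x].
  by move/eqP; rewrite (negPf uv).
rewrite last_rcons => ->; rewrite rcons_path => /andP[_ Fv].
by exists [fset last u p; v]; rewrite // fset22.
Qed.

(** When the star has been revealed, each leaf has its star edge as its only edge, so connectivity
    forces acceptance; irrevocability carries this to the end of the input. *)
Lemma star_path_accepted (A : algorithm R) n : late_accept A ->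
  [fset e in star n.+1] `<=`
    accepted A (star_path_input n) (size (star_path n)).
Proof.
move=> /(_ (star_path_input n))[forest mono].
have le_star : (n.+1 <= size (star_path n))%N.
  by rewrite size_cat !size_mkseq leq_addr.
have {forest} := forest _ le_star; move=> /spanning_forest_revealed.
rewrite /revealed_edges -[edges _]/(star n.+1 ++ rim n).
rewrite take_size_cat ?size_mkseq // => -[/fsubsetP Fs _ conn].
have sub : [fset e in star n.+1] `<=` accepted A (star_path_input n) n.+1.
  apply/fsubsetP => e; rewrite in_fset_seq => e_star.
  have /mapP[i i_n e_i] := e_star.
  have /reachable_edge[//|f fF fi] :
      reachable (accepted A (star_path_input n) n.+1) 0 i.+1.
    by apply: conn; rewrite /adj in_fset_seq -e_i.
  have := Fs f fF; rewrite in_fset_seq => /mapP[j _ f_j].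
  by move: fi; rewrite f_j !inE /= => /eqP[ij]; rewrite e_i ij -f_j.
apply: fsubset_trans sub _.
have H k : (n.+1 + k <= size (star_path n))%N ->
    accepted A (star_path_input n) n.+1
      `<=` accepted A (star_path_input n) (n.+1 + k).
  elim: k => [|k IHk]; first by rewrite addn0 fsubset_refl.
  rewrite addnS => k_n; apply: fsubset_trans (mono _ k_n).
  exact: IHk (ltnW k_n).
by have := H (size (star_path n) - n.+1)%N; rewrite subnKC //; apply.
Qed.

Lemma star_path_alg (A : algorithm R) n :
  late_accept A -> W * n.+1%:R <= alg A (star_path_input n).
Proof.
move=> lA; have sub := star_path_accepted n lA.
have card_star : #|` [fset e in star n.+1]| = n.+1.
  have := star_path_uniq n; rewrite cat_uniq => /andP[Us _].
  by rewrite card_fseq undup_id // size_mkseq.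
apply: le_trans (ler_sum_fsetS _ sub); last first.
  by move=> e; apply/ltW/star_weight_gt0.
rewrite -[in leLHS]card_star -sum_fset_const; apply: ler_sum_fset => e.
by rewrite in_fset_seq => /mapP[i _ ->]; rewrite /= /star_weight fset21.
Qed.

(** The path 0, 1, ..., n+1, made of one star edge and the whole rim. Each recursive step attaches a
    fresh end vertex, which suits [acyclic_add]. *)
Fixpoint long_path n : {fset {fset nat}} :=
  if n is m.+1 then [fset n; n.+1] |` long_path m else [fset [fset 0%N; 1%N]].

Lemma long_path_sub n : long_path n `<=` [fset e in star_path n].
Proof.
apply: (@fsubset_trans _ ([fset 0%N; 1%N] |` [fset e in rim n])); last first.
  apply/fsubsetP => e; rewrite in_fset1U !in_fset_seq.
  rewrite mem_cat.
  case/orP=> [/eqP ->|->]; last by rewrite orbT.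
  by apply/orP; left; apply/mapP; exists 0%N; rewrite // mem_iota.
elim: n => [|n IHn] /=; first by rewrite fsub1set fset1U1.
apply/fsubsetP => e; rewrite in_fset1U in_fset1U !in_fset_seq /rim mkseqS.
move=> /orP[/eqP ->|/(fsubsetP IHn)].
  by rewrite mem_rcons mem_head orbT.
by rewrite in_fset1U in_fset_seq mem_rcons inE => /orP[->|->]; rewrite ?orbT.
Qed.

Lemma long_path_vertex n e i : e \in long_path n -> i \in e -> (i <= n.+1)%N.
Proof.
move=> /(fsubsetP (long_path_sub n)); rewrite in_fset_seq.
by move=> /star_path_simple[_ /fsubsetP sub] /sub; rewrite in_initial_vertices.
Qed.

Lemma long_path_acyclic n : acyclic (long_path n).
Proof.
elim: n => [|n IHn] /=.
  have -> : [fset [fset 0%N; 1%N]] = [fset 0%N; 1%N] |` fset0 by rewrite fsetU0.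
  apply: acyclic_add; first exact: acyclic0.
  by case/reachable_edge => // e; rewrite in_fset0.
apply: acyclic_add IHn _ => /reachable_edge[|e /long_path_vertex le_n /le_n].
  by rewrite ltn_eqF.
by rewrite ltnn.
Qed.

Lemma long_path_reachable n i : (i <= n.+1)%N -> reachable (long_path n) 0 i.
Proof.
elim: n i => [|n IHn] i /=.
  case: i => [|[|//]] _; first exact: reachable_refl.
  by apply: reachable_adj; rewrite /adj fset11.
have sub : long_path n `<=` [fset n.+1; n.+2] |` long_path n.
  exact: fsubsetU1.
rewrite leq_eqVlt => /orP[/eqP ->|]; last first.
  by rewrite ltnS => /IHn /(reachableS sub).
apply: reachable_trans (reachableS sub (IHn n.+1 (leqnn _))) _.
by apply: reachable_adj; rewrite /adj fset1U1.
Qed.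

Lemma long_path_weight n :
  \sum_(e <- long_path n) star_weight e <= (W + n%:R)%R.
Proof.
elim: n => [|n IHn] /=; first by
  rewrite big_seq_fset1 /star_weight fset21 addr0.
rewrite big_fsetU1 /=; last first.
  by apply/negP => /long_path_vertex/(_ (fset22 _ _)); rewrite ltnn.
by rewrite {1}/star_weight !inE /= -[n.+1]add1n natrD addrCA lerD2l.
Qed.

Lemma long_path_forest n : spanning_forest (vertices (star_path_input n))
  (edge_set (star_path_input n)) (long_path n).
Proof.
apply/spanning_forest_input.
split; [exact: long_path_sub|exact: long_path_acyclic|].
move=> u v; rewrite /adj in_fset_seq => /(@star_path_simple n)[_ /fsubsetP sub].
have := sub u (fset21 _ _); have := sub v (fset22 _ _).
rewrite !in_initial_vertices !ltnS.
move=> /long_path_reachable v_n /long_path_reachable u_n.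
exact: reachable_trans (reachable_sym u_n) v_n.
Qed.

(** The lower bound makes the infimum well behaved, and later allows [c] to be replaced by a larger
    factor in front of [opt]. *)
Lemma star_path_opt n : 0 <= opt (star_path_input n) <= (W + n%:R)%R.
Proof.
rewrite /opt; set S := (X in inf X).
have S0 : lbound S 0.
  by move=> _ [F _ <-]; apply: sumr_ge0 => e _; apply/ltW/star_weight_gt0.
have Spath : S (total_weight (star_path_input n) (long_path n)).
  by exists (long_path n) => //; apply: long_path_forest.
apply/andP; split; first by apply: lb_le_inf S0; eexists; apply: Spath.
apply: le_trans (long_path_weight n).
by apply: ge_inf Spath; exists 0.
Qed.

End StarPath.

(** * Combining the two bounds; choice of the input size *)

Theorem theorem15 (R : realType) :
  (exists A : algorithm R,
     late_accept A /\
     forall (W : R) (s : input R),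
       weight_ratio s = W -> alg A s <= W * opt s) /\
  (forall W c : R, 1 <= W -> c < W ->
     ~ exists (A : algorithm R) (alpha : R),
         late_accept A /\
         forall s : input R,
           weight_ratio s = W -> alg A s <= c * opt s + alpha).
Proof.
split=> [|W c W1 cW [A [alpha [lA ub]]]].
  exists (@greedy R); split=> [|W s <-]; first exact: greedy_late_accept.
  exact/late_accept_upper_bound/greedy_late_accept.
(* [c] may be negative, but the upper bound on [opt] can only be multiplied by a nonnegative factor.
   Still [d] is below [W], since [W] is at least 1. *)
pose d := Num.max c 0.
have d0 : 0 <= d by rewrite le_max lexx orbT.
have dW : 0 < W - d by rewrite subr_gt0 gt_max cW (lt_le_trans ltr01).
(* With m rim edges the assumed guarantee gives W (m + 1) <= d (W + m) + alpha, hence m (W - d) <= d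
   W + alpha. Any m above [K] contradicts this; m = [n.+1] is also positive, as [star_path_ratio]
   requires. *)
pose K := (d * W + alpha) / (W - d).
have /archi_boundP := normr_ge0 K; set n := Num.bound _ => Kn.
have {Kn} : K < n.+1%:R.
  by apply: le_lt_trans (ler_norm K) _; apply: lt_trans Kn _; rewrite ltr_nat.
rewrite ltr_pdivrMr // ltNge => /negP; apply.
have := ub _ (star_path_ratio W1 (ltn0Sn n)).
have /andP[opt0 opt_n] := star_path_opt W1 n.+1.
have cd : c * opt (star_path_input W1 n.+1) <= d * (W + n.+1%:R).
  apply: (@le_trans _ _ (d * opt (star_path_input W1 n.+1))).
    by rewrite ler_wpM2r // le_max lexx.
  by rewrite ler_wpM2l.
have := star_path_alg W1 n.+1 lA; rewrite -[n.+2]addn1 natrD.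
move: cd; move: (alg _ _) (c * _) (n.+1)%:R => a b m cd; lra.
Qed.
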